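(* Let $S$ be a program without while loop statements and let $G$ be its control-flow graph. Let $N_1,\dots,N_K$ be all sample nodes in $G$, where $N_k=\mathrm{Assign}(x_k=\mathtt{sample}(E_0^k,f^k(E_1^k,\dots,E_{n_k}^k)))$, and for each $k$ let $$A_k=\mathrm{addresses}(N_k)\cup\bigcup_{i=0}^{n_k}\mathrm{prov}(N_k,E_i^k)\cup\bigcup_{N'\in \mathrm{BP}(N_k)}\mathrm{prov}(N',\mathrm{condexp}(N')).$$ Then there exist functions $p_k\in[\mathcal T|_{A_k}\to\mathbb R_{\ge 0}]$, $k=1,\dots,K$, such that for all traces $\mathtt{tr}\in\mathcal T$, if $p_S(\mathtt{tr})\neq$ undefined, then $$p_S(\mathtt{tr})=p_G(\mathtt{tr})=\prod_{k=1}^K p_k(\mathtt{tr}).$$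
   Context: **Language.** $\mathcal V$ is the set of values (booleans, integers, reals, real vectors, finite strings, and a special value $\mathtt{null}$); $\mathbf{Strings}\subset\mathcal V$ is the set of finite strings (addresses). Expressions: $E::=c\mid x\mid g(E_1,\dots,E_n)$ with $c\in\mathcal V$ a constant, $x$ a program variable (finitely many), $g$ a built-in total function on values. $\mathrm{vars}(E)$ is the set of program variables in $E$. Statements (without while loops): $S::= x=E\mid S_1;S_2\mid \mathtt{if}\,E\,\mathtt{then}\,S_1\,\mathtt{else}\,S_2\mid\mathtt{skip}\mid x=\mathtt{sample}(E_0,f(E_1,\dots,E_n))$, with $f$ a built-in distribution having a function $\mathrm{pdf}_f(v;v_1,\dots,v_n)\in\mathbb R_{\ge0}$. The address expression $E_0$ is assumed to evaluate to a string. A program is a statement. **Traces and states.** A trace is a map $\mathtt{tr}:\mathbf{Strings}\to\mathcal V$; $\mathcal T$ is the set of all traces. A state $\sigma\in\Sigma$ assigns a value to every program variable and a number in $\mathbb R_{\ge0}$ to a reserved variable $\mathbf p$ (not a program variable, not occurring in programs); it is lifted to expressions by $\sigma(c)=c$, $\sigma(g(E_1,\dots,E_n))=g(\sigma(E_1),\dots,\sigma(E_n))$. **Program semantics.** For each trace, $(\sigma,S)\Downarrow^{\mathtt{tr}}\sigma'$ is the least relation closed under: $(\sigma,\mathtt{skip})\Downarrow\sigma$; $(\sigma,x=E)\Downarrow\sigma[x\mapsto\sigma(E)]$; sequencing; $\mathtt{if}$ executes $S_1$ if $\sigma(E)=\mathtt{true}$ and $S_2$ if $\sigma(E)=\mathtt{false}$;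 and if $V_i=\sigma(E_i)\ne\mathtt{null}$ for all $i=0,\dots,n$, $V_0\in\mathbf{Strings}$, $V=\mathtt{tr}(V_0)\neq\mathtt{null}$, then $(\sigma,x=\mathtt{sample}(E_0,f(E_1,\dots,E_n)))\Downarrow\sigma[x\mapsto V,\mathbf p\mapsto\sigma(\mathbf p)\cdot\mathrm{pdf}_f(V;V_1,\dots,V_n)]$. With $\sigma_0$ mapping all program variables to $\mathtt{null}$ and $\mathbf p$ to $1$, $p_S(\mathtt{tr})=\sigma(\mathbf p)$ if $(\sigma_0,S)\Downarrow^{\mathtt{tr}}\sigma$ for some $\sigma$, and undefined otherwise. **CFG.** The control-flow graph $G$ of $S$ is a directed graph with one START, one END node, and branch nodes $\mathrm{Branch}(E)$, join nodes, assign nodes $\mathrm{Assign}(x=E)$ and sample nodes $\mathrm{Assign}(x=\mathtt{sample}(\dots))$ (sample nodes are also assign nodes). Every occurrence of a statement yields its own nodes. $\mathtt{skip}$: START$\to$END. Assignment/sample: START$\to$Assign$\to$END. $S_1;S_2$: remove END of $G_1$ and START of $G_2$ and connect the predecessor of END in $G_1$ to the successor of START in $G_2$. $\mathtt{if}\,E$: START$\to B=\mathrm{Branch}(E)$; $B$ has successors consequent$(B)$ = first node of (the interior of) $G_1$, alternative$(B)$ = first node of $G_2$; the last nodes of $G_1$, $G_2$ go to a join node $J$; $J\to$END (a $\mathtt{skip}$ branch is a direct edge $B\to J$). Then $(B,J)\in\mathrm{BranchJoin}(G)$ and $\mathrm{condexp}(B)=E$. **Graph semantics.** Transitions $(\sigma,N)\xrightarrow{\mathtt{tr}}(\sigma',N')$: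 START and join nodes move to their successor with $\sigma'=\sigma$; $\mathrm{Assign}(x=E)$ moves to its successor with $\sigma'=\sigma[x\mapsto\sigma(E)]$; sample nodes move to their successor with $\sigma'$ as in the sample rule above (under the same conditions); $\mathrm{Branch}(E)$ moves with $\sigma'=\sigma$ to consequent if $\sigma(E)=\mathtt{true}$, to alternative if $\sigma(E)=\mathtt{false}$. $p_G(\mathtt{tr})=\sigma(\mathbf p)$ if there is a finite transition sequence from $(\sigma_0,\mathrm{START})$ to $(\sigma,\mathrm{END})$, undefined otherwise. **Provenance.** $\mathrm{RD}(N,x)$ is the set of assign nodes $N'$ assigning $x$ (including sample nodes) for which there is a path $(N',N_1,\dots,N_n,N)$, $n\ge0$, with no $N_i$ assigning $x$. $\mathrm{BP}(N)=\{B:(B,J)\in\mathrm{BranchJoin}(G),\ \exists\text{ path }(B,\dots,N,\dots,J)\}$. For a sample node with address expression $E_0$, $\mathrm{addresses}(N)=\{\sigma(E_0):\sigma\in\Sigma\}\cap\mathbf{Strings}$. $\mathrm{prov}(N,x)$: let $R$ be the least set of pairs containing $(N,x)$ such that whenever $(M,z)\in R$ and $N'\in\mathrm{RD}(M,z)$, then (i) $(N',y)\in R$ for all $y\in\mathrm{vars}(E')$, where $E'=E$ if $N'=\mathrm{Assign}(z=E)$ and $E'=E_0$ if $N'=\mathrm{Assign}(z=\mathtt{sample}(E_0,\dots))$; (ii) $(B,y)\in R$ for all $B\in\mathrm{BP}(N')$, $y\in\mathrm{vars}(\mathrm{condexp}(B))$. Then $\mathrm{prov}(N,x)$ is the union of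 $\mathrm{addresses}(N')$ over all sample nodes $N'\in\mathrm{RD}(M,z)$ with $(M,z)\in R$. For expressions, $\mathrm{prov}(N,E)=\bigcup_{y\in\mathrm{vars}(E)}\mathrm{prov}(N,y)$. **Restricted functions.** For $A\subseteq\mathbf{Strings}$ and a set $C$, $[\mathcal T|_A\to C]$ is the set of functions $h:\mathcal T\to C$ such that $h(\mathtt{tr})=h(\mathtt{tr}')$ whenever $\mathtt{tr}(\alpha)=\mathtt{tr}'(\alpha)$ for all $\alpha\in A$. *)

(* Defs.v *)
From Stdlib Require String.
From Stdlib Require Import Relation_Operators.
From HB Require Import structures.
From mathcomp Require Import all_boot all_order all_algebra.
From mathcomp Require Import mathcomp_extra boolp classical_sets reals.
From mathcomp Require Import interval_inference.

Set Implicit Arguments.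
Unset Strict Implicit.
Unset Printing Implicit Defensive.

Import Order.TTheory GRing.Theory Num.Theory.
Local Open Scope classical_set_scope.
Local Open Scope ring_scope.

Notation string := String.string.

Inductive value (R : realType) :=
| VBool of bool
| VInt of int
| VReal of R
| VVec (n : nat) of 'rV[R]_n
| VStr of string
| VNull.
Arguments VBool {R}.
Arguments VInt {R}.
Arguments VStr {R}.
Arguments VNull {R}.

(* The language is parametric in the built-in functions and distributions;
   functions are total on values, densities take values in the nonnegative
   reals. *)
Record builtins (R : realType) := Builtins {
  fsym : Type;
  farity : fsym -> nat;
  fsem : forall g : fsym, (farity g).-tuple (value R) -> value R;
  dsym : Type;
  darity : dsym -> nat;
  pdf : forall d : dsym,
    value R -> (darity d).-tuple (value R) -> {nonneg R} }.

Section Language.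
Variables (R : realType) (X : finType) (L : builtins R).

Inductive expr :=
| EConst of value R
| EVar of X
| EApp (g : fsym L) of ('I_(farity g) -> expr).

Fixpoint vars (E : expr) : set X :=
  match E with
  | EConst _ => set0
  | EVar x => [set x]
  | EApp g Es => \bigcup_i vars (Es i)
  end.

(* [SSample x E0 d Es] is  x = sample(E0, d(Es 0, ..., Es (n-1))). *)
Inductive stmt :=
| SSkip
| SAssign of X & expr
| SSeq of stmt & stmt
| SIf of expr & stmt & stmt
| SSample (x : X) (E0 : expr) (d : dsym L) of ('I_(darity d) -> expr).

Definition trace := string -> value R.

(* [weight] is the value of the reserved variable p. *)
Record state := State { store : X -> value R; weight : {nonneg R} }.

Definition upd (s : state) (x : X) (v : value R) : state :=
  State (fun y => if y == x then v else store s y) (weight s).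

Definition scale (s : state) (w : {nonneg R}) : state :=
  State (store s) ((weight s)%:num * w%:num)%:nng.

Fixpoint eval (s : state) (E : expr) : value R :=
  match E with
  | EConst c => c
  | EVar x => store s x
  | EApp g Es => fsem [tuple eval s (Es i) | i < farity g]
  end.

Definition init_state : state := State (fun=> VNull) 1%:nng.

(* The condition on the address covers both V_0 <> null and V_0 in Strings. *)
Inductive sample_rule (tr : trace) (s : state) (x : X) (E0 : expr)
    (d : dsym L) (Es : 'I_(darity d) -> expr) : state -> Prop :=
| Sample_rule (a : string) :
    eval s E0 = VStr a ->
    (forall i, eval s (Es i) <> VNull) ->
    tr a <> VNull ->
    sample_rule tr s x E0 Es
      (scale (upd s x (tr a))
         (pdf (tr a) [tuple eval s (Es i) | i < darity d])).

Inductive run (tr : trace) : state -> stmt -> state -> Prop :=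
| Run_skip s : run tr s SSkip s
| Run_assign s x E : run tr s (SAssign x E) (upd s x (eval s E))
| Run_seq s1 s2 s3 S1 S2 :
    run tr s1 S1 s2 -> run tr s2 S2 s3 -> run tr s1 (SSeq S1 S2) s3
| Run_true s s' E S1 S2 :
    eval s E = VBool true -> run tr s S1 s' -> run tr s (SIf E S1 S2) s'
| Run_false s s' E S1 S2 :
    eval s E = VBool false -> run tr s S2 s' -> run tr s (SIf E S1 S2) s'
| Run_sample s s' x E0 d (Es : 'I_(darity d) -> expr) :
    sample_rule tr s x E0 Es s' -> run tr s (SSample x E0 Es) s'.

(* [None] is "undefined". *)
Definition prog_density (S : stmt) (tr : trace) : option R :=
  xget None [set Some (weight s)%:num | s in [set s | run tr init_state S s]].

Inductive label :=
| LBranch of expr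
| LJoin
| LAssign of X & expr
| LSample (x : X) (E0 : expr) (d : dsym L) of ('I_(darity d) -> expr).

(* [interior] excludes START and END. A possible edge target is an
   [option interior], where [None] is END. [entry] is the successor of START.
   For a branch node, [next B true] is the consequent and [next B false] the
   alternative; every other interior node has one successor, given by both. *)
Record cfg := Cfg {
  interior : finType;
  label_of : interior -> label;
  entry : option interior;
  next : interior -> bool -> option interior;
  branch_join : rel interior }.

(* Embed a subgraph by [f], reconnecting the edges into its END to [t]. *)
Definition redirect (I J : Type) (f : I -> J) (t : option J) (u : option I) :
  option J := if u is Some i then Some (f i) else t.

Definition cfg_skip : cfg :=
  @Cfg void (@of_void _) None (@of_void _) (@of_void _).

Definition cfg_single (l : label) : cfg :=
  @Cfg unit (fun=> l) (Some tt) (fun _ _ => None) (fun _ _ => false).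

Definition cfg_seq (G1 G2 : cfg) : cfg :=
  let t2 := omap inr (entry G2) in
  @Cfg (interior G1 + interior G2)%type
    (fun N => match N with inl i => label_of i | inr i => label_of i end)
    (redirect inl t2 (entry G1))
    (fun N b => match N with
       | inl i => redirect inl t2 (next i b)
       | inr i => omap inr (next i b)
       end)
    (fun N N' => match N, N' with
       | inl i, inl j => branch_join i j
       | inr i, inr j => branch_join i j
       | _, _ => false
       end).

(* [inl true] is the branch node and [inl false] the join node. *)
Definition cfg_if (E : expr) (G1 G2 : cfg) : cfg :=
  let I := (bool + (interior G1 + interior G2))%type in
  let join : option I := Some (inl false) in
  let emb1 (i : interior G1) : I := inr (inl i) in
  let emb2 (i : interior G2) : I := inr (inr i) in
  @Cfg I
    (fun N => match N with
       | inl true => LBranch E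
       | inl false => LJoin
       | inr (inl i) => label_of i
       | inr (inr i) => label_of i
       end)
    (Some (inl true))
    (fun N b => match N with
       | inl true => if b then redirect emb1 join (entry G1)
                     else redirect emb2 join (entry G2)
       | inl false => None
       | inr (inl i) => redirect emb1 join (next i b)
       | inr (inr i) => redirect emb2 join (next i b)
       end)
    (fun N N' => match N, N' with
       | inl true, inl false => true
       | inr (inl i), inr (inl j) => branch_join i j
       | inr (inr i), inr (inr j) => branch_join i j
       | _, _ => false
       end).

Fixpoint cfg_of (S : stmt) : cfg :=
  match S with
  | SSkip => cfg_skip
  | SAssign x E => cfg_single (LAssign x E)
  | SSeq S1 S2 => cfg_seq (cfg_of S1) (cfg_of S2)
  | SIf E S1 S2 => cfg_if E (cfg_of S1) (cfg_of S2)
  | SSample x E0 d Es => cfg_single (LSample x E0 Es)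
  end.

Section Graph.
Variable G : cfg.

(* START is [None]; [Some t] is the edge target [t], so END is [Some None]. *)
Definition node : finType := option (option (interior G)).
Definition START : node := None.
Definition END : node := Some None.
Definition Inner (i : interior G) : node := Some (Some i).

Definition node_label (N : node) : option label :=
  if N is Some (Some i) then Some (label_of i) else None.

Definition edge : rel node := fun N N' =>
  match N with
  | None => N' == Some (entry G)
  | Some None => false
  | Some (Some i) => (N' == Some (next i true)) || (N' == Some (next i false))
  end.

Inductive gstep (tr : trace) : state * node -> state * node -> Prop :=
| Gstep_start s N' : edge START N' -> gstep tr (s, START) (s, N')
| Gstep_join s i N' :
    label_of i = LJoin -> edge (Inner i) N' -> gstep tr (s, Inner i) (s, N')
| Gstep_assign s i x E N' :
    label_of i = LAssign x E -> edge (Inner i) N' ->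
    gstep tr (s, Inner i) (upd s x (eval s E), N')
| Gstep_sample s s' i x E0 d (Es : 'I_(darity d) -> expr) N' :
    label_of i = LSample x E0 Es -> sample_rule tr s x E0 Es s' ->
    edge (Inner i) N' -> gstep tr (s, Inner i) (s', N')
| Gstep_true s i E :
    label_of i = LBranch E -> eval s E = VBool true ->
    gstep tr (s, Inner i) (s, Some (next i true))
| Gstep_false s i E :
    label_of i = LBranch E -> eval s E = VBool false ->
    gstep tr (s, Inner i) (s, Some (next i false)).

Definition cfg_density (tr : trace) : option R :=
  xget None [set Some (weight s)%:num | s in
    [set s | clos_refl_trans_1n _ (gstep tr) (init_state, START) (s, END)]].

Definition is_sample (N : node) : bool :=
  if node_label N is Some (LSample _ _ _ _) then true else false.

Definition assigns (N : node) (x : X) : bool :=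
  match node_label N with
  | Some (LAssign y _) => y == x
  | Some (LSample y _ _ _) => y == x
  | _ => false
  end.

Definition RD (N : node) (x : X) : set node :=
  [set N' | assigns N' x /\
    exists p : seq node,
      path edge N' (rcons p N) /\ all (fun M => ~~ assigns M x) p].

Definition BP (N : node) : set node :=
  [set B | exists i j, [/\ branch_join i j, B = Inner i,
    connect edge B N & connect edge N (Inner j)]].

(* The value at nodes that are not branch nodes is irrelevant. *)
Definition condexp (N : node) : expr :=
  if node_label N is Some (LBranch E) then E else EConst VNull.

(* The expression E' that provenance follows through an assign node: the
   right-hand side of an assignment, the address expression of a sample. The
   value at other nodes is irrelevant. *)
Definition source (N : node) : expr :=
  match node_label N with
  | Some (LAssign _ E) => E
  | Some (LSample _ E0 _ _) => E0
  | _ => EConst VNull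
  end.

Definition addresses (N : node) : set string :=
  [set a | is_sample N /\ exists s : state, eval s (source N) = VStr a].

Inductive prov_rel (N : node) (x : X) : node -> X -> Prop :=
| Prov_base : prov_rel N x N x
| Prov_source M z N' y :
    prov_rel N x M z -> RD M z N' -> vars (source N') y ->
    prov_rel N x N' y
| Prov_branch M z N' B y :
    prov_rel N x M z -> RD M z N' -> BP N' B -> vars (condexp B) y ->
    prov_rel N x B y.

Definition prov (N : node) (x : X) : set string :=
  [set a | exists M z N',
    [/\ prov_rel N x M z, RD M z N', is_sample N' & addresses N' a]].

Definition prov_expr (N : node) (E : expr) : set string :=
  \bigcup_(y in vars E) prov N y.

End Graph.

(* The set [T|_A -> C]. *)
Definition restricted (A : set string) (C : Type) : set (trace -> C) :=
  [set h | forall tr tr' : trace,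
    (forall a, A a -> tr a = tr' a) -> h tr = h tr'].

End Language.

Arguments START {R X L G}.
Arguments END {R X L G}.

(* Main.v *)
Require Import Defs.
From Stdlib Require Import Relation_Operators.
From mathcomp Require Import all_boot all_order all_algebra.
From mathcomp Require Import mathcomp_extra boolp classical_sets reals.
From mathcomp Require Import interval_inference.

Import Order.TTheory GRing.Theory Num.Theory.
Local Open Scope classical_set_scope.
Local Open Scope ring_scope.

Set Implicit Arguments.
Unset Strict Implicit.
Unset Printing Implicit Defensive.

(* Compare two terminating executions whose traces agree on prov(N, x). By
   induction along a topological order of the graph, every pair (M, z) in the
   least set defining prov(N, x) gets the same value of z whenever both
   executions reach M: the branch conditions enclosing a reaching assigner of z
   agree by induction, so both executions pass through the same assigners, hence
   through the same last one, where the source expression agrees by induction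
   and, for a sample node, so do the traces at the sampled address. Consequently
   whether N_k is visited, and the density factor multiplied into the weight
   there, depend only on the trace restricted to A_k among the traces with a
   terminating execution. *)

(* [path.next] shadows the successor function of control-flow graphs. *)
Local Notation next := Defs.next.

(** * Walks in the control-flow graph *)

Section Walks.
Variables (R : realType) (X : finType) (L : builtins R).
Implicit Types (G : cfg X L) (S : stmt X L).

(* A walk lists the nodes it leaves, each with the exit it takes; the exit is
   meaningful only at branch nodes. The walk [p] leads from [u] to [v], where
   [None] is END. *)
Fixpoint walk G (u : option (interior G)) (p : seq (interior G * bool))
    (v : option (interior G)) : bool :=
  if p is (i, b) :: p' then (u == Some i) && walk (next i b) p' v else u == v.

Lemma walk_cat G (u w v : option (interior G)) p q :
  walk u p w -> walk w q v -> walk u (p ++ q) v.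
Proof.
elim: p u => [|[i b] p IH] u /=; first by move=> /eqP ->.
by move=> /andP[-> /IH]; apply.
Qed.

Lemma walk_catE G (u v : option (interior G)) p i b q :
  walk u (p ++ (i, b) :: q) v ->
  walk u p (Some i) /\ walk (next i b) q v.
Proof.
elim: p u => [|[j c] p IH] u /=; first by move=> /andP[/eqP -> ?].
by move=> /andP[-> /IH].
Qed.

(** * Embedding the walks of a subgraph *)

Definition embed (I J : Type) (f : I -> J) (p : seq (I * bool)) :
  seq (J * bool) := [seq (f c.1, c.2) | c <- p].

Lemma mem_embed (I J : eqType) (f : I -> J) (p : seq (I * bool)) i b :
  injective f -> ((f i, b) \in embed f p) = ((i, b) \in p).
Proof.
move=> fI; rewrite -(@mem_map _ _ (fun c : I * bool => (f c.1, c.2))) //.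
by move=> [a c] [a' c'] /= [/fI -> ->].
Qed.

Lemma mem_unzip1_embed (I J : eqType) (f : I -> J) (p : seq (I * bool)) i :
  injective f -> (f i \in unzip1 (embed f p)) = (i \in unzip1 p).
Proof.
move=> fI; rewrite /unzip1 -map_comp.
by rewrite -[RHS](mem_map fI) -map_comp.
Qed.

Lemma mem_embedN (I J : eqType) (f : I -> J) (p : seq (I * bool)) j b :
  (forall i, f i != j) -> ((j, b) \in embed f p) = false.
Proof.
move=> fj; apply/negbTE/mapP => -[c _ [jE _]].
by move: (fj c.1); rewrite jE eqxx.
Qed.

Lemma mem_unzip1_embedN (I J : eqType) (f : I -> J) (p : seq (I * bool)) j :
  (forall i, f i != j) -> (j \in unzip1 (embed f p)) = false.
Proof.
move=> fj; apply/negbTE; rewrite /unzip1 -map_comp; apply/mapP => -[c _ jE].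
by move: (fj c.1); rewrite jE eqxx.
Qed.

Section Embedding.
Variables (G1 G : cfg X L) (f : interior G1 -> interior G).
Variable t : option (interior G).
Hypothesis next_f : forall i b, next (f i) b = redirect f t (next i b).

Lemma walk_embed u p v :
  walk u p v -> walk (redirect f t u) (embed f p) (redirect f t v).
Proof.
elim: p u => [|[i b] p IH] u /=; first by move=> /eqP ->.
by move=> /andP[/eqP -> /IH]; rewrite /= eqxx next_f.
Qed.

(** An edge out of the image of [f] leads back into the image or to [t], so a walk to END can be cut
    where it first gets to [t]. *)
Lemma walk_split u p :
  walk (redirect f t u) p None ->
  exists p1 p2, [/\ p = embed f p1 ++ p2, walk u p1 None & walk t p2 None].
Proof.
elim: p u => [|[j b] p IH] [i|] //=.
- by move=> te; exists [::], [::].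
- move=> /andP[/eqP[<-]]; rewrite next_f => /IH[p1 [p2 [-> w1 w2]]].
  by exists ((i, b) :: p1), p2; split; rewrite //= eqxx.
- by move=> w; exists [::], ((j, b) :: p).
Qed.

End Embedding.

Lemma omap_redirect (I J : Type) (f : I -> J) u : omap f u = redirect f None u.
Proof. by case: u. Qed.

(* The enclosing branches of a node, with the exit leading to it. *)
Fixpoint ctx S : interior (cfg_of S) -> seq (interior (cfg_of S) * bool) :=
  match S return interior (cfg_of S) -> seq (interior (cfg_of S) * bool) with
  | SSkip => fun=> [::]
  | SAssign _ _ => fun=> [::]
  | SSeq S1 S2 => fun N => match N with
      | inl i => embed inl (ctx i)
      | inr i => embed inr (ctx i)
      end
  | SIf _ S1 S2 => fun N => match N with
      | inl _ => [::]
      | inr (inl i) => (inl true, true) :: embed (inr \o inl) (ctx i)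
      | inr (inr i) => (inl true, false) :: embed (inr \o inr) (ctx i)
      end
  | SSample _ _ _ _ => fun=> [::]
  end.

(* A topological order of the control-flow graph. *)
Fixpoint rank S : interior (cfg_of S) -> nat :=
  match S return interior (cfg_of S) -> nat with
  | SSkip => fun=> 0
  | SAssign _ _ => fun=> 0
  | SSeq S1 S2 => fun N => match N with
      | inl i => rank i
      | inr i => #|interior (cfg_of S1)| + rank i
      end
  | SIf _ S1 S2 => fun N => match N with
      | inl true => 0
      | inl false => (#|interior (cfg_of S1)| + #|interior (cfg_of S2)|).+1
      | inr (inl i) => (rank i).+1
      | inr (inr i) => (#|interior (cfg_of S1)| + rank i).+1
      end
  | SSample _ _ _ _ => fun=> 0
  end%N.

(** * Acyclicity *)

Lemma rank_lt S (i : interior (cfg_of S)) : (rank i < #|interior (cfg_of S)|)%N.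
Proof.
elim: S i => [|x E|S1 IH1 S2 IH2|E S1 IH1 S2 IH2|x E0 d Es] //=.
- by case; rewrite card_unit.
- by rewrite card_sum => -[i|i]; rewrite ?ltn_add2l // ltn_addr.
- rewrite !card_sum card_bool => -[[]|[i|i]] //=.
  + by rewrite add2n !ltnS ltnW // ltn_addr.
  + by rewrite add2n !ltnS ltnW // ltn_add2l.
- by case; rewrite card_unit.
Qed.

(** The shifts in [rank] put the second component above the whole first one and the join above both
    branches, so every edge climbs. Hence the graph has no cycle. *)
Lemma rank_next S (i j : interior (cfg_of S)) b :
  next i b = Some j -> (rank i < rank j)%N.
Proof.
elim: S i j b => [|x E|S1 IH1 S2 IH2|E S1 IH1 S2 IH2|x E0 d Es] //=.
- move=> [i|i] j b /=; case E: (next i b) => [k|] //=.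
  + by move=> [<-]; apply: IH1 E.
  + by case: (entry _) => [k|] //= [<-]; rewrite ltn_addr // rank_lt.
  + by move=> [<-]; rewrite ltn_add2l (IH2 _ _ _ E).
- move=> [[]|[i|i]] j b //=.
  + by case: b; case: (entry _) => [k|] //= [<-].
  + case E1: (next i b) => [k|] /= [<-]; first by rewrite ltnS (IH1 _ _ _ E1).
    by rewrite ltnS ltn_addr // rank_lt.
  + case E2: (next i b) => [k|] /= [<-]; first by rewrite ltnS ltn_add2l (IH2 _ _ _ E2).
    by rewrite ltnS ltn_add2l rank_lt.
Qed.

Lemma walk_rank S (i j : interior (cfg_of S)) p b v :
  walk (Some i) p v -> (j, b) \in p -> (rank i <= rank j)%N.
Proof.
elim: p i => [|[k c] p IH] i //= /andP[/eqP[<-{k}] w].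
rewrite inE => /orP[/eqP[-> _] //|jp].
case E: (next i c) w => [k|] w; last by case: p w jp {IH} => [|[]].
by apply: (leq_trans (ltnW (rank_next E))); apply: IH jp.
Qed.

Lemma walk_rank_end S (i j : interior (cfg_of S)) p :
  walk (Some i) p (Some j) -> (rank i <= rank j)%N.
Proof.
elim: p i => [|[k c] p IH] i /=; first by move=> /eqP[->].
move=> /andP[/eqP[<-]]; case E: (next i c) => [l|]; last by case: p {IH} => [|[]].
by move=> /IH; apply: leq_trans; rewrite ltnW // (rank_next E).
Qed.

Lemma walk_rank_next S (i j : interior (cfg_of S)) b p c v :
  walk (next i b) p v -> (j, c) \in p -> (rank i < rank j)%N.
Proof.
case E: (next i b) => [l|] w jp; last by case: p w jp => [|[]].
exact: leq_trans (rank_next E) (walk_rank w jp).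
Qed.

Lemma walk_uniq S (u v : option (interior (cfg_of S))) p :
  walk u p v -> uniq (unzip1 p).
Proof.
elim: p u => [|[i b] p IH] u //= /andP[_ w]; rewrite (IH _ w) andbT.
apply/negP => /mapP[[j c] jp /= ij].
by move: (walk_rank_next w jp); rewrite ij ltnn.
Qed.

(** * Composite graphs and enclosing branches *)

Lemma next_seql (G1 G2 : cfg X L) (i : interior G1) b :
  next (inl i : interior (cfg_seq G1 G2)) b =
  redirect inl (omap inr (entry G2)) (next i b).
Proof. by []. Qed.

(** The END of the second component is the END of the sequence, hence the target [None]. Like its
    neighbours, this equation has the form that [next_f] asks for. *)
Lemma next_seqr (G1 G2 : cfg X L) (i : interior G2) b :
  next (inr i : interior (cfg_seq G1 G2)) b = redirect inr None (next i b).
Proof. exact: omap_redirect. Qed.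

Lemma next_ifl E (G1 G2 : cfg X L) (i : interior G1) b :
  next ((inr \o inl) i : interior (cfg_if E G1 G2)) b =
  redirect (inr \o inl) (Some (inl false)) (next i b).
Proof. by []. Qed.

Lemma next_ifr E (G1 G2 : cfg X L) (i : interior G2) b :
  next ((inr \o inr) i : interior (cfg_if E G1 G2)) b =
  redirect (inr \o inr) (Some (inl false)) (next i b).
Proof. by []. Qed.

(** Supplies the walks from a branch node to a node it encloses and on to the join, which membership
    in [BP] requires. *)
Lemma walk_through S (i : interior (cfg_of S)) :
  (exists p, walk (entry (cfg_of S)) p (Some i)) /\
  (exists p, walk (Some i) p None).
Proof.
(* A component must also be crossed from entry to END; for an empty interior the empty walk does
   it. *)
have entry_end (G : cfg X L) :
    (forall i : interior G, (exists p, walk (entry G) p (Some i)) /\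
       (exists p, walk (Some i) p None)) ->
    exists q, walk (entry G) q None.
  move=> th; case: (entry G) => [j|]; last by exists [::].
  by have [_ [q w]] := th j; exists q.
elim: S i => [|x E|S1 IH1 S2 IH2|E S1 IH1 S2 IH2|x E0 d Es] //=.
- by case; split; [exists [::] | exists [:: (tt, true)]].
- have [q1 w1] := entry_end _ IH1; have [q2 w2] := entry_end _ IH2.
  have {}w1 := walk_embed (@next_seql _ (cfg_of S2)) w1.
  have {}w2 := walk_embed (@next_seqr (cfg_of S1) _) w2.
  move=> [i|i].
  + have [[p wp] [q wq]] := IH1 i; split.
      by exists (embed inl p); exact: (walk_embed (@next_seql _ _) wp).
    exists (embed inl q ++ embed inr q2).
    apply: (walk_cat (walk_embed (@next_seql _ (cfg_of S2)) wq)).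
    by rewrite /= omap_redirect.
  + have [[p wp] [q wq]] := IH2 i; split.
      exists (embed inl q1 ++ embed inr p); apply: (walk_cat w1).
      by rewrite /= omap_redirect; exact: (walk_embed (@next_seqr _ _) wp).
    by exists (embed inr q); exact: (walk_embed (@next_seqr _ _) wq).
- have [q1 w1] := entry_end _ IH1.
  have {}w1 := walk_embed (@next_ifl E _ (cfg_of S2)) w1.
  move=> [[]|[i|i]].
  + split; first by exists [::].
    exists ((inl true, true) :: embed (inr \o inl) q1 ++ [:: (inl false, true)]).
    by rewrite /= ?eqxx; apply: (walk_cat w1); rewrite /= ?eqxx.
  + split; last by exists [:: (inl false, true)].
    exists ((inl true, true) :: embed (inr \o inl) q1).
    by rewrite /= ?eqxx.
  + have [[p wp] [q wq]] := IH1 i; split.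
      exists ((inl true, true) :: embed (inr \o inl) p); rewrite /= ?eqxx.
      exact: (walk_embed (@next_ifl E _ (cfg_of S2)) wp).
    exists (embed (inr \o inl) q ++ [:: (inl false, true)]).
    apply: (walk_cat (walk_embed (@next_ifl E _ (cfg_of S2)) wq)).
    by rewrite /= ?eqxx.
  + have [[p wp] [q wq]] := IH2 i; split.
      exists ((inl true, false) :: embed (inr \o inr) p); rewrite /= ?eqxx.
      exact: (walk_embed (@next_ifr E (cfg_of S1) _) wp).
    exists (embed (inr \o inr) q ++ [:: (inl false, true)]).
    apply: (walk_cat (walk_embed (@next_ifr E (cfg_of S1) _) wq)).
    by rewrite /= ?eqxx.
- by case; split; [exists [::] | exists [:: (tt, true)]].
Qed.

(** Links the syntactic [ctx] to the graph. For the outermost branch, a walk through [i] inside its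
    subgraph is embedded, with END redirected to the join; for inner branches the walks given by
    induction are embedded. *)
Lemma ctxP S (B i : interior (cfg_of S)) b :
  (B, b) \in ctx i ->
  exists E J p q, [/\ label_of B = LBranch E, branch_join B J,
    walk (next B b) p (Some i) & walk (Some i) q (Some J)].
Proof.
elim: S B i b => [|x E|S1 IH1 S2 IH2|E S1 IH1 S2 IH2|x E0 d Es] //=.
- move=> B [i|i] b /mapP[[C c] /= Ci [-> ->]].
  + have [E [J [p [q [lb bj wp wq]]]]] := IH1 _ _ _ Ci.
    exists E, (inl J), (embed inl p), (embed inl q); split => //.
      exact: (walk_embed (@next_seql _ _) wp).
    exact: (walk_embed (@next_seql _ (cfg_of S2)) wq).
  + have [E [J [p [q [lb bj wp wq]]]]] := IH2 _ _ _ Ci.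
    exists E, (inr J), (embed inr p), (embed inr q); split => //.
      by rewrite /= omap_redirect; exact: (walk_embed (@next_seqr _ _) wp).
    exact: (walk_embed (@next_seqr (cfg_of S1) _) wq).
- move=> B [//|[i|i]] b; rewrite inE => /orP[/eqP[-> ->]|/mapP[[C c] /= Ci [-> ->]]].
  + have [[p wp] [q wq]] := walk_through i.
    exists E, (inl false), (embed (inr \o inl) p), (embed (inr \o inl) q).
    split=> //; first exact: (walk_embed (@next_ifl E _ (cfg_of S2)) wp).
    exact: (walk_embed (@next_ifl E _ (cfg_of S2)) wq).
  + have [E' [J [p [q [lb bj wp wq]]]]] := IH1 _ _ _ Ci.
    exists E', (inr (inl J)), (embed (inr \o inl) p), (embed (inr \o inl) q).
    split=> //; first exact: (walk_embed (@next_ifl E _ (cfg_of S2)) wp).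
    exact: (walk_embed (@next_ifl E _ (cfg_of S2)) wq).
  + have [[p wp] [q wq]] := walk_through i.
    exists E, (inl false), (embed (inr \o inr) p), (embed (inr \o inr) q).
    split=> //; first exact: (walk_embed (@next_ifr E (cfg_of S1) _) wp).
    exact: (walk_embed (@next_ifr E (cfg_of S1) _) wq).
  + have [E' [J [p [q [lb bj wp wq]]]]] := IH2 _ _ _ Ci.
    exists E', (inr (inr J)), (embed (inr \o inr) p), (embed (inr \o inr) q).
    split=> //; first exact: (walk_embed (@next_ifr E (cfg_of S1) _) wp).
    exact: (walk_embed (@next_ifr E (cfg_of S1) _) wq).
Qed.

Lemma sub_embed (I J : eqType) (f : I -> J) (p q : seq (I * bool)) :
  {subset p <= q} -> {subset embed f p <= embed f q}.
Proof. by move=> pq _ /mapP[c /pq cq ->]; apply: map_f. Qed.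

Lemma ctx_trans S (B i : interior (cfg_of S)) b :
  (B, b) \in ctx i -> {subset ctx B <= ctx i}.
Proof.
elim: S B i b => [|x E|S1 IH1 S2 IH2|E S1 IH1 S2 IH2|x E0 d Es] //=.
- move=> B [i|i] b /mapP[[C c] /= Ci [-> _]]; apply: sub_embed.
    exact: IH1 Ci.
  exact: IH2 Ci.
- move=> B [//|[i|i]] b;
    rewrite inE => /orP[/eqP[-> _] //|/mapP[[C c] /= Ci [-> _]]] a;
    rewrite !inE => /orP[-> //|aC]; apply/orP; right;
    apply: sub_embed aC.
    exact: IH1 Ci.
  exact: IH2 Ci.
Qed.

Lemma ctx_rank S (B i : interior (cfg_of S)) b :
  (B, b) \in ctx i -> (rank B < rank i)%N.
Proof.
move=> /ctxP[E [J [p [q [_ _ w _]]]]].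
case nB: (next B b) w => [k|] w; last by case: p w => [|[]].
exact: leq_trans (rank_next nB) (walk_rank_end w).
Qed.

(** Control flow is structured: a complete walk decomposes into complete walks of the components it
    enters, so only the exits taken at enclosing branches decide whether a node is met. *)
Lemma visited_ctx S p (i : interior (cfg_of S)) :
  walk (entry (cfg_of S)) p None ->
  (i \in unzip1 p) = all (fun c => c \in p) (ctx i).
Proof.
have all_embed (I J : eqType) (f : I -> J) (q r : seq (I * bool)) (P : seq (J * bool)) :
    (forall c, ((f c.1, c.2) \in P) = (c \in q)) ->
    all (fun c => c \in P) (embed f r) = all (fun c => c \in q) r.
  by move=> Pq; rewrite all_map; apply: eq_all => c /=.
have unzip1_cat (I J : Type) (q r : seq (I * J)) :
  unzip1 (q ++ r) = unzip1 q ++ unzip1 r by exact: map_cat.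
have inlI (I J : Type) : injective (@inl I J) by move=> ? ? [].
have inrI (I J : Type) : injective (@inr I J) by move=> ? ? [].
have inrlI (I J K : Type) : injective ((@inr K _) \o @inl I J) by move=> ? ? [].
have inrrI (I J K : Type) : injective ((@inr K _) \o @inr I J) by move=> ? ? [].
elim: S p i => [|x E|S1 IH1 S2 IH2|E S1 IH1 S2 IH2|x E0 d Es] //=.
- by case=> [|[[] b] p] // [].
- move=> p i /(walk_split (@next_seql _ (cfg_of S2)))[p1 [p2 [-> w1]]].
  rewrite omap_redirect => /(walk_split (@next_seqr (cfg_of S1) _)).
  (* The remainder [p3] starts at END, so it is empty. *)
  move=> [{}p2 [p3 [-> w2]]]; case: p3 => [_|[//]]; rewrite cats0.
  case: i => i; rewrite unzip1_cat mem_cat.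
  + rewrite (mem_unzip1_embed _ _ (inlI _ _)) mem_unzip1_embedN // orbF (IH1 _ _ w1).
    rewrite (all_embed _ _ _ p1) // => c.
    by rewrite mem_cat (mem_embed _ _ _ (inlI _ _)) mem_embedN // orbF; case: c.
  + rewrite mem_unzip1_embedN // (mem_unzip1_embed _ _ (inrI _ _)) (IH2 _ _ w2).
    rewrite (all_embed _ _ _ p2) // => c.
    by rewrite mem_cat mem_embedN // (mem_embed _ _ _ (inrI _ _)); case: c.
- move=> [|[j b] p] i //= /andP[/eqP[<-] w].
  case: b w => w.
  + have [p1 [p2 [-> w1]]] := walk_split (@next_ifl E _ (cfg_of S2)) w.
    (* After the consequent only the join is left, since its successor is END. *)
    case: p2 => [//|[k c] p2 /andP[/eqP[<-]]]; case: p2 => [_|[//]].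
    case: i => [[]|[i|i]] //=.
    * by rewrite inE unzip1_cat mem_cat mem_seq1 eqxx !orbT.
    * rewrite !inE unzip1_cat mem_cat (mem_unzip1_embed _ _ (inrlI _ _ _)).
      rewrite mem_seq1 /= orbF (IH1 _ _ w1) (all_embed _ _ _ p1) // => a.
      by rewrite inE mem_cat (mem_embed _ _ _ (inrlI _ _ _)) mem_seq1 orbF; case: a.
    (* A node of the alternative is not on the walk, and its context asks for the exit not taken:
       both sides are false. *)
    * rewrite !inE unzip1_cat mem_cat mem_unzip1_embedN //.
      by rewrite mem_cat mem_embedN.
  + have [p1 [p2 [-> w2]]] := walk_split (@next_ifr E (cfg_of S1) _) w.
    case: p2 => [//|[k c] p2 /andP[/eqP[<-]]]; case: p2 => [_|[//]].
    case: i => [[]|[i|i]] //=.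
    * by rewrite inE unzip1_cat mem_cat mem_seq1 eqxx !orbT.
    * rewrite !inE unzip1_cat mem_cat mem_unzip1_embedN //.
      by rewrite mem_cat mem_embedN.
    * rewrite !inE unzip1_cat mem_cat (mem_unzip1_embed _ _ (inrrI _ _ _)).
      rewrite mem_seq1 /= orbF (IH2 _ _ w2) (all_embed _ _ _ p1) // => a.
      by rewrite inE mem_cat (mem_embed _ _ _ (inrrI _ _ _)) mem_seq1 orbF; case: a.
- by case=> [|[[] b] p] // [].
Qed.

End Walks.

(** * Executions along walks *)

Section Executions.
Variables (R : realType) (X : finType) (L : builtins R).
Implicit Types (G : cfg X L) (S : stmt X L) (tr : trace R) (s : state R X).

(** The effect of a transition, separated from the choice of the successor; [b] is constrained at
    branches only. *)
Definition action tr (l : label X L) (b : bool) s s' : Prop :=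
  match l with
  | LBranch E => eval s E = VBool b /\ s' = s
  | LJoin => s' = s
  | LAssign x E => s' = upd s x (eval s E)
  | LSample x E0 d Es => sample_rule tr s x E0 Es s'
  end.

Fixpoint exec G tr s (u : option (interior G)) (p : seq (interior G * bool))
    s' (v : option (interior G)) : Prop :=
  if p is (i, b) :: p' then
    u = Some i /\ exists2 s1, action tr (label_of i) b s s1 &
                              exec tr s1 (next i b) p' s' v
  else s = s' /\ u = v.

Lemma exec_walk G tr s (u : option (interior G)) p s' v :
  exec tr s u p s' v -> walk u p v.
Proof.
elim: p s u => [|[i b] p IH] s u /=; first by move=> [_ ->].
by move=> [-> [s1 _ /IH ->]]; rewrite eqxx.
Qed.

Lemma exec_cat G tr s s1 s2 (u w v : option (interior G)) p q :
  exec tr s u p s1 w -> exec tr s1 w q s2 v -> exec tr s u (p ++ q) s2 v.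
Proof.
elim: p s u => [|[i b] p IH] s u /=; first by move=> [-> ->].
by move=> [-> [s3 a /IH e]] /e ?; split=> //; exists s3.
Qed.

Lemma exec_catE G tr s s' (u v : option (interior G)) p q :
  exec tr s u (p ++ q) s' v ->
  exists s1 w, exec tr s u p s1 w /\ exec tr s1 w q s' v.
Proof.
elim: p s u => [|[i b] p IH] s u /=; first by exists s, u.
move=> [-> [s2 a /IH[s1 [w [e1 e2]]]]]; exists s1, w; split=> //.
by split=> //; exists s2.
Qed.

Lemma exec_embed G1 G (f : interior G1 -> interior G) t tr s u p s' v :
  (forall i b, next (f i) b = redirect f t (next i b)) ->
  (forall i, label_of (f i) = label_of i) ->
  exec tr s u p s' v ->
  exec tr s (redirect f t u) (embed f p) s' (redirect f t v).
Proof.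
move=> nf lf; elim: p s u => [|[i b] p IH] s u /=; first by move=> [-> ->].
move=> [-> [s1 a /IH e]]; split=> //; exists s1; first by rewrite lf.
by rewrite nf.
Qed.

(** Executions of the components are embedded and concatenated; a conditional adds one step at the
    branch node and one at the join. *)
Lemma run_exec tr s S s' :
  run tr s S s' -> exists p, exec tr s (entry (cfg_of S)) p s' None.
Proof.
elim=> {s S s'}.
- by move=> s; exists [::].
- by move=> s x E; exists [:: (tt, true)]; split=> //; exists (upd s x (eval s E)).
- move=> s1 s2 s3 S1 S2 _ [p e1] _ [q e2].
  have {}e1 := exec_embed (@next_seql _ _ _ (cfg_of S1) (cfg_of S2)) (fun=> erefl) e1.
  have {}e2 := exec_embed (@next_seqr _ _ _ (cfg_of S1) (cfg_of S2)) (fun=> erefl) e2.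
  exists (embed inl p ++ embed inr q); apply: (exec_cat e1).
  by rewrite /= omap_redirect.
- move=> s1 s2 E S1 S2 Et _ [p e].
  have {}e := exec_embed (@next_ifl _ _ _ E (cfg_of S1) (cfg_of S2)) (fun=> erefl) e.
  (* The exit recorded at the join is arbitrary, as both lead to END. *)
  exists ((inl true, true) :: embed (inr \o inl) p ++ [:: (inl false, true)]).
  split=> //; exists s1 => //; apply: (exec_cat e).
  by split=> //; exists s2.
- move=> s1 s2 E S1 S2 Ef _ [p e].
  have {}e := exec_embed (@next_ifr _ _ _ E (cfg_of S1) (cfg_of S2)) (fun=> erefl) e.
  exists ((inl true, false) :: embed (inr \o inr) p ++ [:: (inl false, true)]).
  split=> //; exists s1 => //; apply: (exec_cat e).
  by split=> //; exists s2.
- by move=> s s' x E0 d Es sr; exists [:: (tt, true)]; split=> //; exists s'.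
Qed.

(** * Determinism of the graph semantics *)

(** [gstep] lets a node that is not a branch follow either exit; determinism rests on the two being
    equal. *)
Lemma next_nonbranch S (i : interior (cfg_of S)) b c :
  (forall E, label_of i <> LBranch E) -> next i b = next i c.
Proof.
elim: S i => [|x E|S1 IH1 S2 IH2|E S1 IH1 S2 IH2|x E0 d Es] //=.
- by move=> [i|i] nb; rewrite ?(IH1 _ nb) ?(IH2 _ nb).
- by move=> [[]|[i|i]] nb; rewrite ?(IH1 _ nb) ?(IH2 _ nb) //; case: (nb E).
Qed.

Lemma action_det tr l b c s s1 s2 :
  action tr l b s s1 -> action tr l c s s2 ->
  s1 = s2 /\ (forall E, l = LBranch E -> b = c).
Proof.
case: l => [E||x E|x E0 d Es] /=.
- by move=> [Eb ->] [Ec ->]; split=> // E' _; move: Eb; rewrite Ec => -[].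
- by move=> -> ->.
- by move=> -> ->.
- by move=> [a Ea _ _] [a' Ea' _ _]; move: Ea'; rewrite Ea => -[<-].
Qed.

Lemma gstep_inner G tr s (i : interior G) c :
  gstep tr (s, Inner i) c ->
  exists b s', action tr (label_of i) b s s' /\ c = (s', Some (next i b)).
Proof.
have exit N' : edge (Inner i) N' -> exists b, N' = Some (next i b).
  by move=> /orP[/eqP|/eqP] ->; [exists true | exists false].
move cE: (s, Inner i) => c0 st; case: st cE.
- by [].
- by move=> s0 j N' lj ed [-> ij]; move: lj ed; rewrite -ij => -> /exit[b ->];
    exists b, s0.
- by move=> s0 j x E N' lj ed [-> ij]; move: lj ed; rewrite -ij => -> /exit[b ->];
    exists b, (upd s0 x (eval s0 E)).
- by move=> s0 s' j x E0 d Es N' lj sr ed [-> ij]; move: lj ed;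
    rewrite -ij => -> /exit[b ->]; exists b, s'.
- by move=> s0 j E lj Eb [-> ij]; move: lj; rewrite -ij => ->; exists true, s0.
- by move=> s0 j E lj Eb [-> ij]; move: lj; rewrite -ij => ->; exists false, s0.
Qed.

Lemma edge_next G (i : interior G) b : edge (Inner i) (Some (next i b)).
Proof. by case: b; rewrite /= eqxx ?orbT. Qed.

Lemma action_gstep G tr s (i : interior G) b s' :
  action tr (label_of i) b s s' -> gstep tr (s, Inner i) (s', Some (next i b)).
Proof.
have ed := edge_next i b; case li: (label_of i) => [E||x E|x E0 d Es] /=.
- by case: b {ed} => -[Eb ->]; [apply: Gstep_true li _|apply: Gstep_false li _].
- by move=> ->; apply: Gstep_join.
- by move=> ->; apply: Gstep_assign.
- by move=> sr; apply: Gstep_sample sr _.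
Qed.

Lemma exec_gsteps G tr s (u : option (interior G)) p s' v :
  exec tr s u p s' v ->
  clos_refl_trans_1n _ (gstep tr) (s, Some u) (s', Some v).
Proof.
elim: p s u => [|[i b] p IH] s u /=; first by move=> [-> ->]; constructor.
move=> [-> [s1 a /IH]]; apply: rt1n_trans; exact: action_gstep.
Qed.

Lemma gstep_det S tr c c1 c2 :
  @gstep _ _ _ (cfg_of S) tr c c1 -> gstep tr c c2 -> c1 = c2.
Proof.
case: c => s [[i|]|].
- move=> /gstep_inner[b [s1 [a1 ->]]] /gstep_inner[b' [s2 [a2 ->]]].
  have [<- bb'] := action_det a1 a2.
  case li: (label_of i) => [E||x E|x E0 d Es];
    by rewrite ?(bb' _ li) // (@next_nonbranch _ i b b') // li.
- by move=> st; move cE: (s, Some None) st => c st; case: st cE.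
- have start c' : gstep tr (s, START) c' -> c' = (s, Some (entry (cfg_of S))).
    move cE: (s, START) => c st; case: st cE => //.
    by move=> s0 N' /eqP -> [->].
  by move=> /start -> /start ->.
Qed.

(** No transition leaves END, so neither of two deterministic sequences that stop there can be a
    proper prefix of the other. *)
Lemma gsteps_det S tr c s1 s2 :
  clos_refl_trans_1n _ (@gstep _ _ _ (cfg_of S) tr) c (s1, END) ->
  clos_refl_trans_1n _ (gstep tr) c (s2, END) -> s1 = s2.
Proof.
have stuck s c' : ~ @gstep _ _ _ (cfg_of S) tr (s, END) c'.
  by move cE: (s, END) => c0 st; case: st cE.
move eE: (s1, END) => e st; elim: st eE => {c e} [c <- st|c c' e st _ IH /IH{}IH st'].
  move dE: (s2, END) st => d st; case: st dE => [[->] //|c1 ? g _ _].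
  by case: (stuck _ _ g).
move dE: (s2, END) st' => d st'; case: st' dE => [dE|c1 d' g rest dE].
  by move: st; rewrite -dE => /stuck.
by apply: IH; rewrite (gstep_det st g) dE.
Qed.

(* The two densities agree because both are read off the final state of an
   execution, which is unique. *)
Lemma densitiesE S tr :
  prog_density S tr <> None ->
  exists p s, [/\ exec tr (init_state R X) (entry (cfg_of S)) p s None,
    prog_density S tr = Some (weight s)%:num &
    cfg_density (cfg_of S) tr = Some (weight s)%:num].
Proof.
rewrite /prog_density; case: xgetP => // _ -> /= [s sr <-] _.
have [p e] := run_exec sr; exists p, s; split=> //.
have st : clos_refl_trans_1n _ (@gstep _ _ _ (cfg_of S) tr)
    (init_state R X, START) (s, END).
  by apply: rt1n_trans (exec_gsteps e); apply: Gstep_start; rewrite /= eqxx.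
apply: xget_unique; first by exists s.
by move=> _ [s' st' <-]; rewrite (gsteps_det st st').
Qed.

End Executions.

(** * Soundness of provenance *)

Section Provenance.
Variables (R : realType) (X : finType) (L : builtins R) (S : stmt X L).
Local Notation G := (cfg_of S).
Local Notation s0 := (init_state R X).
Local Notation e0 := (entry G).
Implicit Types (tr : trace R) (s : state R X) (p : seq (interior G * bool)).

Lemma eval_ext s s' (E : expr X L) :
  (forall y, vars E y -> store s y = store s' y) -> eval s E = eval s' E.
Proof.
elim: E => [c|x|g Es IH] //= vE; first exact: vE.
congr (fsem _); apply: eq_from_tnth => i; rewrite !tnth_mktuple.
by apply: IH => y yi; apply: vE; exists i.
Qed.

(** * From walks to reaching definitions and branch parents *)

Lemma walk_next_rank (i j : interior G) b p :
  walk (next i b) p (Some j) -> (rank i < rank j)%N.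
Proof.
case ni: (next i b) => [k|] w; last by case: p w => [|[]].
exact: leq_trans (rank_next ni) (walk_rank_end w).
Qed.

Lemma walk_rank_before (u : option (interior G)) p i j :
  walk u p (Some i) -> j \in unzip1 p -> (rank j < rank i)%N.
Proof.
move=> w /mapP[[j' b] /= jp ->]; case/splitPr: jp w => p1 p2.
by move=> /walk_catE[_]; apply: walk_next_rank.
Qed.

Lemma walk_connect (u v : option (interior G)) p :
  walk u p v -> connect (@edge _ _ _ G) (Some u) (Some v).
Proof.
elim: p u => [|[i b] p IH] u /=; first by move=> /eqP ->.
move=> /andP[/eqP -> /IH]; apply: connect_trans; apply: connect1.
exact: edge_next.
Qed.

Lemma walk_path (i : interior G) b p v :
  walk (next i b) p v ->
  path (@edge _ _ _ G) (Inner i) (rcons [seq Inner c.1 | c <- p] (Some v)).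
Proof.
elim: p i b => [|[j c] p IH] i b /=.
  by move=> /eqP <-; rewrite andbT; exact: edge_next.
by move=> /andP[/eqP nij /IH ->]; rewrite andbT; move: (edge_next i b); rewrite nij.
Qed.

(** The branches that decide whether a node is visited are thus among those that provenance
    follows. *)
Lemma ctx_BP (B i : interior G) b : (B, b) \in ctx i -> BP (Inner i) (Inner B).
Proof.
move=> /ctxP[E [J [p [q [_ bj wp wq]]]]]; exists B, J; split=> //.
- by apply: (@walk_connect _ _ ((B, b) :: p)); rewrite /= eqxx.
- exact: walk_connect wq.
Qed.

(** * Assignments along an execution *)

Definition assigner x (c : interior G * bool) := assigns (Inner c.1) x.

Lemma walk_RD (i j : interior G) b p x :
  walk (next i b) p (Some j) -> assigns (Inner i) x -> ~~ has (assigner x) p ->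
  RD (Inner j) x (Inner i).
Proof.
move=> w ai np; split=> //; exists [seq Inner c.1 | c <- p]; split.
  exact: walk_path w.
by rewrite all_map -(eq_all (a1 := predC (assigner x))) // all_predC.
Qed.

Lemma action_store tr (i : interior G) b s s' x :
  action tr (label_of i) b s s' -> ~~ assigns (Inner i) x ->
  store s' x = store s x.
Proof.
rewrite /assigns /=; case: (label_of i) => [E||y E|y E0 d Es] /=.
- by move=> [_ ->].
- by move=> ->.
- by move=> -> /=; rewrite eq_sym => /negbTE ->.
- by move=> [a _ _ _] /=; rewrite eq_sym => /negbTE ->.
Qed.

(** At a sample node, equal source values mean that both traces are read at the same address, which
    lies in [addresses] with [s] as its witness. *)
Lemma action_value tr tr' (i : interior G) b b' s s' t t' x :
  action tr (label_of i) b s s' -> action tr' (label_of i) b' t t' ->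
  assigns (Inner i) x -> eval s (source (Inner i)) = eval t (source (Inner i)) ->
  (forall a, addresses (Inner i) a -> tr a = tr' a) -> store s' x = store t' x.
Proof.
rewrite /assigns /addresses /is_sample /source /=.
case: (label_of i) => [E||y E|y E0 d Es] //=.
  by move=> -> -> /eqP -> /= -> _; rewrite eqxx.
move=> [a Ea _ _] [a' Ea' _ _] /eqP -> /=; rewrite eqxx Ea Ea' => -[<-].
by apply; split=> //; exists s.
Qed.

(** The stretch [p2] after the last assigner is the path that makes it a reaching definition at [v],
    by [walk_RD]. *)
Lemma last_assigner tr s u p s1 v x :
  exec tr s u p s1 v ->
  (~~ has (assigner x) p /\ store s1 x = store s x) \/
  exists p1 i b p2 s2 s3, [/\ p = p1 ++ (i, b) :: p2,
    exec tr s u p1 s2 (Some i), action tr (label_of i) b s2 s3,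
    assigns (Inner i) x &
    [/\ walk (next i b) p2 v, ~~ has (assigner x) p2 & store s1 x = store s3 x]].
Proof.
elim: p s u => [|[i b] p IH] s u /=; first by move=> [-> _]; left.
move=> [-> [s' a e]]; case: (IH _ _ e) => [[np sx]|].
  have [ai|nai] := boolP (assigns (Inner i) x).
    right; exists [::], i, b, p, s, s'; split=> //; split=> //.
    exact: exec_walk e.
  by left; rewrite negb_or nai np sx (action_store a).
move=> [p1 [j [c [p2 [s2 [s3 [-> e1 a' aj r]]]]]]]; right.
exists ((i, b) :: p1), j, c, p2, s2, s3; split=> //=.
by split=> //; exists s'.
Qed.

(** [s1] is the state before the action of [i]. The action is included because at a branch it ties
    the exit [b] to the value of the condition in [s1]. *)
Definition arrival tr s u p (i : interior G) b s1 :=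
  exists p1 p2 s2, [/\ p = p1 ++ (i, b) :: p2, exec tr s u p1 s1 (Some i) &
    action tr (label_of i) b s1 s2].

Lemma mem_arrival tr s u p s' v i b :
  exec tr s u p s' v -> (i, b) \in p -> exists s1, arrival tr s u p i b s1.
Proof.
move=> e /path.splitPr ip; case: ip e => p1 p2.
move=> /exec_catE[s1 [w [e1 [wi [s2 a _]]]]]; exists s1, p1, p2, s2; split=> //.
by rewrite -wi.
Qed.

(** * Comparing two terminating executions *)

Section TwoExecutions.
Variables (tr tr' : trace R) (p p' : seq (interior G * bool)).
Variables (sf sf' : state R X).
Hypothesis e : exec tr s0 e0 p sf None.
Hypothesis e' : exec tr' s0 e0 p' sf' None.

(** By induction on the rank, the second execution also reaches each branch enclosing [N]; equal
    conditions make it take the same exits, and [visited_ctx] concludes. *)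
Lemma visited_transfer N :
  (forall B a b b' s s', (B, a) \in ctx N -> arrival tr s0 e0 p B b s ->
     arrival tr' s0 e0 p' B b' s' ->
     eval s (condexp (Inner B)) = eval s' (condexp (Inner B))) ->
  N \in unzip1 p -> N \in unzip1 p'.
Proof.
have [n] := ubnP (rank N); elim: n N => // n IH N Nn same.
rewrite (visited_ctx N (exec_walk e)) (visited_ctx N (exec_walk e')) => /allP all_p.
apply/allP => -[B b] BN; have Bp := all_p _ BN.
have : B \in unzip1 p'.
  apply: IH (map_f _ Bp); first exact: leq_trans (ctx_rank BN) Nn.
  (* A branch enclosing [B] also encloses [N], so the hypothesis on conditions passes to [B]. *)
  by move=> C a c c' s s' CB; apply: (same C a); apply: ctx_trans BN _ CB.
move=> /mapP[[B' b'] Bp' /= BE]; rewrite -{}BE in Bp'.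
have [s ar] := mem_arrival e Bp; have [s' ar'] := mem_arrival e' Bp'.
have := same _ _ _ _ _ _ BN ar ar'.
have [E [_ [_ [_ [lB _ _ _]]]]] := ctxP BN; rewrite /condexp /= lB.
move: ar ar' => [_ [_ [s1 [_ _]]]]; rewrite lB => -[-> _].
by move=> [_ [_ [s1' [_ _]]]]; rewrite lB => -[-> _] [->].
Qed.

End TwoExecutions.

(** Nodes after [i] on the walk have larger rank, so a visited node of smaller rank must come before
    it. *)
Lemma arrival_walk tr s u p i b s1 sf v :
  exec tr s u p sf v -> arrival tr s u p i b s1 ->
  exists p1 b1 p2, [/\ p = p1 ++ (i, b1) :: p2, exec tr s u p1 s1 (Some i) &
    forall j, j \in unzip1 p -> (rank j < rank i)%N -> j \in unzip1 p1].
Proof.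
move=> /exec_walk w [p1 [p2 [s2 [pE e1 _]]]]; exists p1, b, p2; split=> // j.
move: w; rewrite pE => /walk_catE[_ w].
rewrite /unzip1 map_cat mem_cat inE => /or3P[//|/eqP -> /=|/mapP[[j' c] jp ->] /=].
  by rewrite ltnn.
by move=> /(ltn_trans (walk_rank_next w jp)); rewrite ltnn.
Qed.

(** Used in both directions, this forces the last assigners of two executions to coincide: otherwise
    each would have smaller rank than the other. *)
Lemma last_assigner_rank u q (i j : interior G) b p x :
  walk u q (Some i) -> ~~ has (assigner x) p -> assigns (Inner j) x ->
  j \in unzip1 (q ++ (i, b) :: p) -> j = i \/ (rank j < rank i)%N.
Proof.
move=> w /hasPn np aj; rewrite /unzip1 map_cat mem_cat inE.
case/or3P => [jq|/eqP|/mapP[[j' c] jp jE]]; [right|by left|].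
  exact: walk_rank_before w jq.
by have := np _ jp; rewrite /assigner /= -[j']/((j', c).1) -jE aj.
Qed.

Section Agreement.
Variables (tr tr' : trace R) (p p' : seq (interior G * bool)).
Variables (sf sf' : state R X) (N0 : node G) (x0 : X).
Hypothesis e : exec tr s0 e0 p sf None.
Hypothesis e' : exec tr' s0 e0 p' sf' None.
Hypothesis agree : forall a, prov N0 x0 a -> tr a = tr' a.

(** The induction on the rank of [M] closes because an assigner that reaches [M] and its enclosing
    branches have smaller rank, while [Prov_source] and [Prov_branch] keep the pairs met there in
    the relation. *)
Lemma prov_sound M z b b' s s' :
  prov_rel N0 x0 (Inner M) z -> arrival tr s0 e0 p M b s ->
  arrival tr' s0 e0 p' M b' s' -> store s z = store s' z.
Proof.
have [n] := ubnP (rank M); elim: n M z b b' s s' => // n IH M z b b' s s' Mn Rz.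
have eq_at N (E : expr X L) : (rank N < rank M)%N ->
    (forall y, vars E y -> prov_rel N0 x0 (Inner N) y) ->
    forall c c' t t', arrival tr s0 e0 p N c t -> arrival tr' s0 e0 p' N c' t' ->
    eval t E = eval t' E.
  move=> NM RE c c' t t' ar ar'; apply: eval_ext => y /RE Ry.
  by apply: IH Ry ar ar'; apply: leq_trans NM Mn.
have eq_cond N : RD (Inner M) z (Inner N) -> (rank N < rank M)%N ->
    forall B a c c' t t', (B, a) \in ctx N -> arrival tr s0 e0 p B c t ->
    arrival tr' s0 e0 p' B c' t' ->
    eval t (condexp (Inner B)) = eval t' (condexp (Inner B)).
  move=> rd NM B a c c' t t' BN; apply: eq_at.
    exact: ltn_trans (ctx_rank BN) NM.
  by move=> y; apply: Prov_branch Rz rd (ctx_BP BN).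
have to_p' N : RD (Inner M) z (Inner N) -> (rank N < rank M)%N ->
    N \in unzip1 p -> N \in unzip1 p'.
  move=> rd NM; apply: (visited_transfer e e').
  by move=> B a c c' t t'; apply: eq_cond.
have to_p N : RD (Inner M) z (Inner N) -> (rank N < rank M)%N ->
    N \in unzip1 p' -> N \in unzip1 p.
  move=> rd NM; apply: (visited_transfer e' e).
  by move=> B a c c' t t' BN ar' ar; apply/esym; apply: eq_cond BN ar ar'.
move=> /(arrival_walk e)[p1 [b1 [p2 [pE e1 before]]]].
move=> /(arrival_walk e')[p1' [b1' [p2' [pE' e1' before']]]].
have no_assigner N q : ~~ has (assigner z) q -> assigns (Inner N) z ->
    N \notin unzip1 q.
  move=> /hasPn nq aN; apply/negP => /mapP[[N' c] Nq NE].
  by have := nq _ Nq; rewrite /assigner -NE aN.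
(* If neither execution assigns [z] before [M], both hold its initial value. If just one does, its
   assigner is visited by the other too, and before [M]: a contradiction. *)
have [[n1 ->]|] := last_assigner z e1; have [[n1' ->]|] := last_assigner z e1'.
- by [].
- move=> [q [N [c [r [t [t1 [qE eN aN asN [wN nr _]]]]]]]].
  have NM := walk_next_rank wN; have rd := walk_RD wN asN nr.
  have Np : N \in unzip1 p.
    by apply: to_p; rewrite // pE' qE /unzip1 !map_cat !mem_cat inE eqxx orbT.
  by move: (no_assigner _ _ n1 asN); rewrite before.
- move=> [q [N [c [r [t [t1 [qE eN aN asN [wN nr _]]]]]]]].
  have NM := walk_next_rank wN; have rd := walk_RD wN asN nr.
  have Np : N \in unzip1 p'.
    by apply: to_p'; rewrite // pE qE /unzip1 !map_cat !mem_cat inE eqxx orbT.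
  by move: (no_assigner _ _ n1' asN); rewrite before'.
move=> [q' [N' [c' [r' [t' [t1' [qE' eN' aN' asN' [wN' nr' ->]]]]]]]].
move=> [q [N [c [r [t [t1 [qE eN aN asN [wN nr ->]]]]]]]].
have NM := walk_next_rank wN; have rd := walk_RD wN asN nr.
have NM' := walk_next_rank wN'; have rd' := walk_RD wN' asN' nr'.
(* Each last assigner is visited by the other execution, and before [M] since its rank is
   smaller. *)
have Np : N \in unzip1 p1'.
  apply: before' => //; apply: to_p' => //.
  by rewrite pE qE /unzip1 !map_cat !mem_cat inE eqxx orbT.
have Np' : N' \in unzip1 p1.
  apply: before => //; apply: to_p => //.
  by rewrite pE' qE' /unzip1 !map_cat !mem_cat inE eqxx orbT.
have NN' : N = N'.
  move: Np Np'; rewrite qE qE'.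
  move=> /(last_assigner_rank (exec_walk eN') nr' asN)[//|lt1].
  move=> /(last_assigner_rank (exec_walk eN) nr asN')[//|lt2].
  by move: (ltn_trans lt1 lt2); rewrite ltnn.
subst N'; apply: (action_value aN aN' asN).
  have ar : arrival tr s0 e0 p N c t.
    by exists q, (r ++ (M, b1) :: p2), t1; split=> //; rewrite pE qE -catA.
  have ar' : arrival tr' s0 e0 p' N c' t'.
    by exists q', (r' ++ (M, b1') :: p2'), t1'; split=> //; rewrite pE' qE' -catA.
  by apply: eq_at NM _ _ _ _ _ ar ar' => y; apply: Prov_source Rz rd.
(* The addresses of a sample node in [RD M z] belong to the provenance by definition. *)
by move=> a aNa; apply: agree; exists (Inner M), z, (Inner N); split=> //; case: aNa.
Qed.

End Agreement.

(** * The density factors *)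

(** The value 1 for an address that is not a string is a default that no sample action meets. *)
Definition density tr (l : label X L) s : {nonneg R} :=
  if l is LSample _ E0 d Es then
    if eval s E0 is VStr a then pdf (tr a) [tuple eval s (Es i) | i < darity d]
    else 1%:nng
  else 1%:nng.

Lemma action_weight tr l b s s' :
  action tr l b s s' ->
  (weight s')%:num = (weight s)%:num * (density tr l s)%:num.
Proof.
case: l => [E||x E|x E0 d Es] /=.
- by move=> [_ ->]; rewrite mulr1.
- by move=> ->; rewrite mulr1.
- by move=> ->; rewrite mulr1.
- by move=> [a -> _ _].
Qed.

(** A walk meets each node at most once, so its factors can be indexed by all nodes, with 1 at those
    not visited. *)
Lemma weight_prod tr s u p s' v :
  exec tr s u p s' v -> uniq (unzip1 p) ->
  exists c : node G -> {nonneg R}, [/\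
    forall N, N \notin [seq Inner j | j <- unzip1 p] -> c N = 1%:nng,
    forall i, i \in unzip1 p -> exists b s1,
      arrival tr s u p i b s1 /\ c (Inner i) = density tr (label_of i) s1 &
    (weight s')%:num = (weight s)%:num * \prod_N (c N)%:num].
Proof.
elim: p s u => [|[i b] p IH] s u /=.
  move=> [-> _] _; exists (fun=> 1%:nng); split=> //.
  by rewrite big1 ?mulr1.
move=> [-> [s1 a e]] /andP[ip /(IH _ _ e)[c [c1 cp wE]]].
(* The rest of the walk avoids [i], so replacing [c] at [i] multiplies the product by exactly the
   new density. *)
have cNi : c (Inner i) = 1%:nng.
  by apply: c1; apply/negP => /mapP[j jp [ij]]; rewrite ij jp in ip.
exists (fun N => if N == Inner i then density tr (label_of i) s else c N).
split=> [N|j|].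
- by rewrite inE negb_or => /andP[/negbTE -> /c1].
- rewrite inE => /orP[/eqP ->|jp].
    rewrite eqxx; exists b, s; split=> //; exists [::], p, s1; split=> //.
  have [c' [s2 [[p1 [p2 [s3 [pE e1 a1]]]] cj]]] := cp _ jp.
  exists c', s2; split.
    exists ((i, b) :: p1), p2, s3; split=> //; first by rewrite pE.
    by split=> //; exists s1.
  by case: eqP jp ip => // -[->] ->.
- rewrite wE (action_weight a) (bigD1 (Inner i)) //= cNi mul1r.
  rewrite [in RHS](bigD1 (Inner i)) //= eqxx mulrA; congr (_ * _).
  by apply: eq_bigr => N /negbTE ->.
Qed.

(** A relation, since a trace may have no terminating execution. *)
Definition contribution tr (i : interior G) (w : {nonneg R}) :=
  exists p sf, exec tr s0 e0 p sf None /\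
    ((i \notin unzip1 p /\ w = 1%:nng) \/
     exists b s, arrival tr s0 e0 p i b s /\ w = density tr (label_of i) s).

(** The set $A_k$ at the sample node $N_k$, with a default at other nodes. *)
Definition dependencies (N : node G) : set string :=
  if node_label N is Some (LSample x E0 d Es) then
    addresses N
    `|` (prov_expr N E0 `|` \bigcup_i prov_expr N (Es i))
    `|` \bigcup_(B in BP N) prov_expr B (condexp B)
  else set0.

Lemma arrival_mem tr s u p i b s1 : arrival tr s u p i b s1 -> i \in unzip1 p.
Proof.
move=> [p1 [p2 [_ [-> _ _]]]].
by rewrite /unzip1 map_cat mem_cat inE eqxx orbT.
Qed.

(** Each part of $A_k$ fixes one ingredient: the branch conditions fix whether [i] is visited, the
    provenance of [E0] the address, [addresses] the sampled value, and the provenance of the [Es]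
    the parameters. *)
Lemma contribution_unique tr tr' i w w' :
  is_sample (Inner i) ->
  (forall a, dependencies (Inner i) a -> tr a = tr' a) ->
  contribution tr i w -> contribution tr' i w' -> w = w'.
Proof.
move=> si agree [p [sf [e h]]] [p' [sf' [e' h']]].
have eq_at M (E : expr X L) : (forall a, prov_expr (Inner M) E a -> tr a = tr' a) ->
    forall b b' s s', arrival tr s0 e0 p M b s -> arrival tr' s0 e0 p' M b' s' ->
    eval s E = eval s' E.
  move=> agE b b' s s' ar ar'; apply: eval_ext => y yE.
  (* Soundness is used at the starting pair of the provenance relation. *)
  apply: (prov_sound e e') (Prov_base _ _) ar ar' => a ya.
  by apply: agE; exists y.
have eq_cond B b c c' s s' : (B, b) \in ctx i ->
    arrival tr s0 e0 p B c s -> arrival tr' s0 e0 p' B c' s' ->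
    eval s (condexp (Inner B)) = eval s' (condexp (Inner B)).
  move=> Bi; apply: eq_at => a Ba; apply: agree; move: si.
  rewrite /is_sample /dependencies /=; case: (label_of i) => // *.
  by right; exists (Inner B) => //; apply: ctx_BP Bi.
have to_p' : i \in unzip1 p -> i \in unzip1 p'.
  by apply: (visited_transfer e e') => B b c c' s s'; apply: eq_cond.
have to_p : i \in unzip1 p' -> i \in unzip1 p.
  apply: (visited_transfer e' e) => B b c c' s s' BN ar' ar.
  by apply/esym; apply: eq_cond BN ar ar'.
case: h h' => [[ni ->]|[b [s [ar ->]]]] [[ni' ->]|[b' [s' [ar' ->]]]] //.
- by rewrite (to_p (arrival_mem ar')) in ni.
- by rewrite (to_p' (arrival_mem ar)) in ni'.
have [_ [_ [s1 [_ _]]]] := ar; have [_ [_ [s1' [_ _]]]] := ar'.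
move: si agree; rewrite /is_sample /dependencies /addresses /source /is_sample /=.
case: (label_of i) => //= x E0 d Es _ agree.
move=> [a' Ea' _ _] [a Ea _ _]; rewrite Ea Ea'.
have : VStr a = VStr a' :> value R.
  rewrite -Ea -Ea'; apply: eq_at ar ar' => c Ec; apply: agree.
  by left; right; left.
move=> [aa']; rewrite aa'.
have <- : tr a' = tr' a'.
  by apply: agree; left; left; split=> //; exists s'; rewrite Ea' -?aa'.
congr (pdf _ _); apply: eq_from_tnth => k; rewrite !tnth_mktuple.
apply: eq_at ar ar' => c Ec; apply: agree.
by left; right; right; exists k.
Qed.

(* The factor is read off any terminating execution whose trace agrees with
   [tr] on the dependencies of [N]; the default 1 only serves traces for which
   there is none. *)
Definition factor (N : node G) tr : {nonneg R} :=
  if N is Some (Some i) then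
    xget 1%:nng [set w | exists tr',
      (forall a, dependencies N a -> tr a = tr' a) /\ contribution tr' i w]
  else 1%:nng.

(** Traces that agree on the dependencies have the same set of candidates, and [xget] depends on
    that set alone. *)
Lemma factor_restricted N : restricted (dependencies N) (factor N).
Proof.
move=> tr tr' agree; case: N agree => [[i|]|] agree //=; congr xget.
apply/seteqP; split=> w [t [at_ cw]]; exists t; split=> // a da.
  by rewrite -agree ?at_.
by rewrite agree ?at_.
Qed.

(** The trace itself supplies a candidate, and [contribution_unique] excludes any other. *)
Lemma factor_unique tr i w :
  is_sample (Inner i) -> contribution tr i w -> factor (Inner i) tr = w.
Proof.
move=> si cw; apply: xget_unique; first by exists tr.
move=> w' [tr' [agree cw']].
by apply/esym; apply: (contribution_unique si agree cw cw').
Qed.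

Lemma prod_factor tr p s :
  exec tr s0 e0 p s None ->
  (weight s)%:num = \prod_(N : node G | is_sample N) (factor N tr)%:num.
Proof.
move=> e; have [c [c1 cp ->]] := weight_prod e (walk_uniq (exec_walk e)).
rewrite mul1r [RHS]big_mkcond; apply: eq_bigr => N _.
have [Np|Np] := boolP (N \in [seq Inner j | j <- unzip1 p]).
  have [i ip ->] := mapP Np; have [b [s1 [ar cE]]] := cp i ip.
  have [si|nsi] := boolP (is_sample _).
    congr (_%:num); apply/esym; apply: factor_unique si _.
    by exists p, s; split=> //; right; exists b, s1.
  (* A visited node that is not a sample node has density 1. *)
  by rewrite cE; move: nsi; rewrite /is_sample /=; case: (label_of i).
(* A sample node that is not visited contributes 1, and its factor is 1 as well. *)
rewrite (c1 _ Np); case: ifP => // sN; case: N sN Np => // -[] // i si Np.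
congr (_%:num); apply/esym; apply: factor_unique si _; exists p, s; split=> //.
by left; split=> //; apply: contra Np; apply: map_f.
Qed.

End Provenance.

Theorem theorem1 (R : realType) (X : finType) (L : builtins R)
    (S : stmt X L) :
  let G := cfg_of S in
  exists p : node G -> trace R -> {nonneg R},
    (forall (N : node G) (x : X) (E0 : expr X L) (d : dsym L)
        (Es : 'I_(darity d) -> expr X L),
      node_label N = Some (LSample x E0 Es) ->
      restricted
        (addresses N
         `|` (prov_expr N E0 `|` \bigcup_i prov_expr N (Es i))
         `|` \bigcup_(B in BP N) prov_expr B (condexp B))
        (p N)) /\
    (forall tr : trace R,
      prog_density S tr <> None ->
      prog_density S tr = cfg_density G tr /\
      cfg_density G tr = Some (\prod_(N : node G | is_sample N) (p N tr)%:num)).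
Proof.
move=> G; exists (@factor R X L S); split=> [N x E0 d Es lN|tr].
  by have := @factor_restricted R X L S N; rewrite /dependencies lN.
move=> /densitiesE[p [s [e -> ->]]]; split=> //.
by rewrite (prod_factor e).
Qed.
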